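(* Let $\Lambda$ be a locally convex, row-finite $k$-graph and let $R$ be a (nonzero) commutative ring with $1$. For a hereditary, saturated subset $G$ of $\Lambda^0$ let $J_G$ be the ideal of $\mathrm{KP}_R(\Lambda)$ generated by $\{p_v:v\in G\}$. Then $G\mapsto J_G$ is a lattice isomorphism from the hereditary, saturated subsets of $\Lambda^0$ to the basic graded ideals of $\mathrm{KP}_R(\Lambda)$ (both ordered by inclusion).
   Context: $\mathbb N=\{0,1,2,\dots\}$, $k\geq 1$ is an integer, $e_1,\dots,e_k$ is the standard basis of $\mathbb N^k$, and $\leq$ on $\mathbb N^k$ is coordinatewise. A $k$-graph is a countable category $\Lambda$ with a functor $d:\Lambda\to\mathbb N^k$ (degree) satisfying the factorisation property: if $d(\lambda)=m+n$ with $m,n\in\mathbb N^k$, there are unique $\mu,\nu\in\Lambda$ with $d(\mu)=m$, $d(\nu)=n$, $\lambda=\mu\nu$. Morphisms are called paths; the set $\Lambda^0$ of objects (vertices) is identified with the set of paths of degree $0$; $r,s:\Lambda\to\Lambda^0$ are the codomain (range) and domain (source) maps, so $\lambda\mu$ is defined iff $s(\lambda)=r(\mu)$. Write $\Lambda^n=d^{-1}(n)$, $\Lambda^{\neq0}=\Lambda\setminus\Lambda^0$, $v\Lambda=\{\lambda:r(\lambda)=v\}$, $v\Lambda^n=v\Lambda\cap\Lambda^n$. $\Lambda$ is row-finite if every $v\Lambda^n$ is finite. $\Lambda$ is locally convex if for all $v\in\Lambda^0$, $i\neq j$, $\lambda\in v\Lambda^{e_i}$, $\mu\in v\Lambda^{e_j}$,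 the sets $s(\lambda)\Lambda^{e_j}$ and $s(\mu)\Lambda^{e_i}$ are nonempty. For $n\in\mathbb N^k$, $\Lambda^{\leq n}=\{\lambda\in\Lambda: d(\lambda)\leq n,\text{ and } d(\lambda)_i<n_i\text{ implies } s(\lambda)\Lambda^{e_i}=\emptyset\}$, and $v\Lambda^{\leq n}=v\Lambda\cap\Lambda^{\leq n}$. A subset $H\subseteq\Lambda^0$ is hereditary if $v\in H$ and $r(\lambda)=v$ imply $s(\lambda)\in H$; it is saturated if for $v\in\Lambda^0$, $s(v\Lambda^{\leq e_i})\subseteq H$ for some $i\in\{1,\dots,k\}$ implies $v\in H$. Kumjian-Pask families: for each $\lambda\in\Lambda^{\neq 0}$ let $\lambda^*$ be a formal symbol; for $v\in\Lambda^0$ put $v^*=v$. $R$-algebras are associative but need not be unital. A Kumjian-Pask $\Lambda$-family $(P,S)$ in an $R$-algebra $A$ consists of elements $P_v$ ($v\in\Lambda^0$), $S_\lambda,S_{\lambda^*}$ ($\lambda\in\Lambda^{\neq0}$) of $A$ such that, with the convention $S_v=S_{v^*}=P_v$: (KP1) $P_vP_w=\delta_{v,w}P_v$; (KP2) $S_\lambda S_\mu=S_{\lambda\mu}$ and $S_{\mu^*}S_{\lambda^*}=S_{(\lambda\mu)^*}$ when $r(\mu)=s(\lambda)$, and $P_{r(\lambda)}S_\lambda=S_\lambda=S_\lambda P_{s(\lambda)}$, $P_{s(\lambda)}S_{\lambda^*}=S_{\lambda^*}=S_{\lambda^*}P_{r(\lambda)}$; (KP3$'$) $S_{\lambda^*}S_\mu=\delta_{\lambda,\mu}P_{s(\lambda)}$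 for all $n\in\mathbb N^k\setminus\{0\}$ and $\lambda,\mu\in\Lambda^{\leq n}$; (KP4$'$) $P_v=\sum_{\lambda\in v\Lambda^{\leq n}}S_\lambda S_{\lambda^*}$ for all $v\in\Lambda^0$, $n\in\mathbb N^k\setminus\{0\}$. $\mathrm{KP}_R(\Lambda)$ is the $R$-algebra generated by a universal Kumjian-Pask $\Lambda$-family $(p,s)$; it is $\mathbb Z^k$-graded by $\mathrm{KP}_R(\Lambda)_n=\operatorname{span}_R\{s_\alpha s_{\beta^*}:d(\alpha)-d(\beta)=n\}$. Ideals are two-sided. An ideal $I$ is graded if it is spanned by $\bigcup_n(I\cap\mathrm{KP}_R(\Lambda)_n)$, and basic if $rp_v\in I$ for some $v\in\Lambda^0$, $r\in R\setminus\{0\}$ implies $p_v\in I$. *)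

(* Defs.v *)
From HB Require Import structures.
From mathcomp Require Import all_boot all_order all_algebra.
From mathcomp Require Import boolp classical_sets functions cardinality fsbigop.

Set Implicit Arguments.
Unset Strict Implicit.
Unset Printing Implicit Defensive.

Import GRing.Theory.
Local Open Scope classical_set_scope.
Local Open Scope ring_scope.

(** * Higher-rank graphs *)

Section Degrees.
Variable k : nat.

Definition deg_le (m n : 'rV[nat]_k) : Prop := forall i, (m ord0 i <= n ord0 i)%N.

Definition unit_deg (i : 'I_k) : 'rV[nat]_k := delta_mx ord0 i.

Definition zdeg (m : 'rV[nat]_k) : 'rV[int]_k := map_mx Posz m.

End Degrees.

(* A countable category with a degree functor.  Composition is a total
   function, but is only constrained on composable pairs, i.e. [kcomp l m] is
   meaningful only when [src l = rng m].  Under [kid], vertices are in bijection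
   with the paths of degree 0 (by the factorisation property). *)
Record kgraph (k : nat) := KGraph {
  vertex : countType;
  kpath : countType;
  rng : kpath -> vertex;
  src : kpath -> vertex;
  kid : vertex -> kpath;
  kcomp : kpath -> kpath -> kpath;
  deg : kpath -> 'rV[nat]_k;
  rng_id : forall v, rng (kid v) = v;
  src_id : forall v, src (kid v) = v;
  rng_comp : forall l m, src l = rng m -> rng (kcomp l m) = rng l;
  src_comp : forall l m, src l = rng m -> src (kcomp l m) = src m;
  comp_idl : forall l, kcomp (kid (rng l)) l = l;
  comp_idr : forall l, kcomp l (kid (src l)) = l;
  compA : forall l m n, src l = rng m -> src m = rng n ->
    kcomp l (kcomp m n) = kcomp (kcomp l m) n;
  deg_id : forall v, deg (kid v) = 0;
  deg_comp : forall l m, src l = rng m -> deg (kcomp l m) = deg l + deg m;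
  factorisation : forall l (m n : 'rV[nat]_k), deg l = m + n ->
    exists! p : kpath * kpath,
      [/\ deg p.1 = m, deg p.2 = n, src p.1 = rng p.2 & l = kcomp p.1 p.2]
}.

Section GraphNotions.
Variables (k : nat) (L : kgraph k).
Implicit Types (v : vertex L) (n : 'rV[nat]_k) (H : set (vertex L)).

Definition paths_from v n : set (kpath L) := [set l | rng l = v /\ deg l = n].

Definition paths_le n : set (kpath L) :=
  [set l | deg_le (deg l) n /\
     forall i, (deg l ord0 i < n ord0 i)%N -> paths_from (src l) (unit_deg i) = set0].

Definition paths_le_from v n : set (kpath L) :=
  [set l | rng l = v] `&` paths_le n.

Definition row_finite : Prop := forall v n, finite_set (paths_from v n).

Definition locally_convex : Prop :=
  forall v (i j : 'I_k) (l m : kpath L), i <> j ->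
    paths_from v (unit_deg i) l -> paths_from v (unit_deg j) m ->
    paths_from (src l) (unit_deg j) !=set0 /\
    paths_from (src m) (unit_deg i) !=set0.

Definition hereditary H : Prop := forall l : kpath L, H (rng l) -> H (src l).

Definition saturated H : Prop :=
  forall v, (exists i : 'I_k, @src k L @` paths_le_from v (unit_deg i) `<=` H) ->
    H v.

End GraphNotions.

(** * Associative, not necessarily unital, algebras over a commutative ring *)

Record nualg (R : comNzRingType) := NuAlg {
  nualg_mod :> lmodType R;
  amul : nualg_mod -> nualg_mod -> nualg_mod;
  amulA : associative amul;
  amulDl : left_distributive amul +%R;
  amulDr : right_distributive amul +%R;
  amulZl : forall a x y, amul (a *: x) y = a *: amul x y;
  amulZr : forall a x y, amul x (a *: y) = a *: amul x y
}.

Declare Scope nualg_scope.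
Delimit Scope nualg_scope with nualg.
Notation "x ** y" := (amul x y) (at level 40, left associativity) : nualg_scope.
Local Open Scope nualg_scope.

Section Algebras.
Variables (R : comNzRingType).

Definition multiplicative_map (A B : nualg R) (f : A -> B) : Prop :=
  forall x y, f (x ** y) = f x ** f y.

Definition is_submodule (V : lmodType R) (U : set V) : Prop :=
  [/\ U 0, forall x y, U x -> U y -> U (x + y) & forall a x, U x -> U (a *: x)].

Definition lspan (V : lmodType R) (X : set V) : set V :=
  smallest (@is_submodule V) X.

Definition is_ideal (A : nualg R) (I : set A) : Prop :=
  is_submodule I /\ forall a x, I x -> I (a ** x) /\ I (x ** a).

Definition ideal_generated (A : nualg R) (X : set A) : set A :=
  smallest (@is_ideal A) X.

End Algebras.

(** * Kumjian-Pask families and algebras *)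

(* [kpS l] is S_l and [kpT l] is S_{l^*}; the convention S_v = S_{v^*} = P_v on
   paths of degree 0 is recorded by [kpS_id] and [kpT_id]. *)
Record kp_family (k : nat) (L : kgraph k) (R : comNzRingType) (A : nualg R) :=
KPFamily {
  kpP : vertex L -> A;
  kpS : kpath L -> A;
  kpT : kpath L -> A;
  kpS_id : forall v, kpS (kid v) = kpP v;
  kpT_id : forall v, kpT (kid v) = kpP v;
  kp1 : forall v w, kpP v ** kpP w = kpP v *+ (v == w);
  kp2S : forall l m, src l = rng m -> kpS l ** kpS m = kpS (kcomp l m);
  kp2T : forall l m, src l = rng m -> kpT m ** kpT l = kpT (kcomp l m);
  kp2PS : forall l, kpP (rng l) ** kpS l = kpS l;
  kp2SP : forall l, kpS l ** kpP (src l) = kpS l;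
  kp2PT : forall l, kpP (src l) ** kpT l = kpT l;
  kp2TP : forall l, kpT l ** kpP (rng l) = kpT l;
  kp3 : forall (n : 'rV[nat]_k) l m, n <> 0 ->
    paths_le n l -> paths_le n m ->
    kpT l ** kpS m = kpP (src l) *+ (l == m);
  kp4 : forall v (n : 'rV[nat]_k), n <> 0 ->
    kpP v = \sum_(l \in paths_le_from v n) (kpS l ** kpT l)
}.

Section KumjianPask.
Variables (k : nat) (L : kgraph k) (R : comNzRingType).

Definition kp_morphism (A B : nualg R) (p : kp_family L A) (q : kp_family L B)
    (f : {linear A -> B}) : Prop :=
  [/\ multiplicative_map f,
      forall v, f (kpP p v) = kpP q v,
      forall l, f (kpS p l) = kpS q l &
      forall l, f (kpT p l) = kpT q l].

(* [A] together with [p] is KP_R(L).  Uniqueness of the morphism forces [p] to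
   generate [A]. *)
Definition universal_kp_family (A : nualg R) (p : kp_family L A) : Prop :=
  forall (B : nualg R) (q : kp_family L B),
    exists f : {linear A -> B}, kp_morphism p q f /\
      forall g : {linear A -> B}, kp_morphism p q g -> f =1 g.

Variables (A : nualg R) (p : kp_family L A).

Definition kp_component (n : 'rV[int]_k) : set A :=
  lspan [set x | exists a b : kpath L,
    zdeg (deg a) - zdeg (deg b) = n /\ x = kpS p a ** kpT p b].

Definition graded_ideal (I : set A) : Prop :=
  is_ideal I /\ I = lspan (\bigcup_n (I `&` kp_component n)).

Definition basic_ideal (I : set A) : Prop :=
  is_ideal I /\ forall v (r : R), r <> 0 -> I (r *: kpP p v) -> I (kpP p v).

End KumjianPask.

(** * Lattices of sets ordered by inclusion *)

Section InclusionLattices.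

(* Meets and joins are taken inside the family [F]: they are the greatest lower
   and least upper bounds among members of [F], not intersections and unions. *)
Definition is_meet (T : Type) (F : set (set T)) (X Y Z : set T) : Prop :=
  [/\ F Z, Z `<=` X, Z `<=` Y &
      forall W, F W -> W `<=` X -> W `<=` Y -> W `<=` Z].

Definition is_join (T : Type) (F : set (set T)) (X Y Z : set T) : Prop :=
  [/\ F Z, X `<=` Z, Y `<=` Z &
      forall W, F W -> X `<=` W -> Y `<=` W -> Z `<=` W].

Definition inclusion_lattice (T : Type) (F : set (set T)) : Prop :=
  forall X Y, F X -> F Y ->
    (exists Z, is_meet F X Y Z) /\ (exists Z, is_join F X Y Z).

Definition lattice_isomorphism (T U : Type) (F : set (set T)) (E : set (set U))
    (f : set T -> set U) : Prop :=
  [/\ inclusion_lattice F, inclusion_lattice E, set_bij F E f,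
      forall X Y Z, F X -> F Y -> is_meet F X Y Z -> is_meet E (f X) (f Y) (f Z) &
      forall X Y Z, F X -> F Y -> is_join F X Y Z -> is_join E (f X) (f Y) (f Z)].

End InclusionLattices.

(* Main.v *)
Require Import Defs.
From HB Require Import structures.
From mathcomp Require Import all_boot all_order all_algebra.
From mathcomp Require Import boolp classical_sets functions cardinality fsbigop.
From mathcomp Require Import finmap zify.

(** The inverse of [G |-> J_G] is [I |-> H_I = {v : p_v in I}].

    For [J_(H_I) = I]: a homogeneous [x] in [I] can be expanded by (KP4') as a sum
    of [c(a,b) s_a s_b^*] over distinct pairs with all [b] in the same
    [Lambda^(<= n)]; then (KP3') gives [s_a^* x s_b = c(a,b) p_(s(a))], so basicness
    puts every [s(a)] with [c(a,b) <> 0] in [H_I].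

    For [H_(J_G) = G] and basicness of [J_G]: [KP_R(Lambda)] acts on the
    [R]-valued functions on the boundary paths all of whose vertices avoid [G].
    The generators of [J_G] act by 0, whereas [r p_v] acts nontrivially when
    [r <> 0] and [v] is outside [G], since saturation of [G] yields such a boundary
    path starting at [v]. *)

Set Implicit Arguments.
Unset Strict Implicit.
Unset Printing Implicit Defensive.

Import GRing.Theory.
Local Open Scope classical_set_scope.
Local Open Scope ring_scope.

(** * Paths *)

Section Degrees.
Variable k : nat.
Implicit Types m n : 'rV[nat]_k.

Lemma addrVE m n i : (m + n) ord0 i = (m ord0 i + n ord0 i)%N.
Proof. by rewrite mxE. Qed.

Lemma unit_degE (i j : 'I_k) : unit_deg i ord0 j = (j == i).
Proof. by rewrite /unit_deg mxE eqxx /=; case: (j == i). Qed.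

Lemma degP m n : (forall i, m ord0 i = n ord0 i) -> m = n.
Proof. by move=> h; apply/rowP. Qed.

Definition min_deg m n : 'rV[nat]_k := \row_i minn (m ord0 i) (n ord0 i).
Definition sub_deg m n : 'rV[nat]_k := \row_i (m ord0 i - n ord0 i)%N.

Lemma min_degE m n i : min_deg m n ord0 i = minn (m ord0 i) (n ord0 i).
Proof. by rewrite mxE. Qed.

Lemma sub_degE m n i : sub_deg m n ord0 i = (m ord0 i - n ord0 i)%N.
Proof. by rewrite mxE. Qed.

Lemma deg_addI m n n' : m + n = m + n' -> n = n'.
Proof.
move=> e; apply: degP => i; move/rowP/(_ i): e; rewrite !addrVE; lia.
Qed.

Lemma subdegK m n : deg_le m n -> m + sub_deg n m = n.
Proof.
by move=> h; apply: degP => i; rewrite addrVE sub_degE; have := h i; lia.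
Qed.

Lemma zdegD m n : zdeg (m + n) = zdeg m + zdeg n.
Proof. by apply/rowP => i; rewrite !mxE. Qed.

Lemma zdeg_inj : injective (@zdeg k).
Proof. by move=> m n /rowP e; apply: degP => i; have := e i; rewrite !mxE => -[]. Qed.

End Degrees.

(** * Factorisation of paths and the sets $\Lambda^{\leq n}$ *)

Section Paths.
Variables (k : nat) (L : kgraph k).
Hypothesis (Lconv : locally_convex L).
Implicit Types (v : vertex L) (l m a b : kpath L) (n : 'rV[nat]_k).

Lemma factor l (m n : 'rV[nat]_k) : deg l = m + n ->
  exists a b, [/\ deg a = m, deg b = n, src a = rng b & l = kcomp a b].
Proof.
by move=> /factorisation [[a b] [/= [h1 h2 h3 h4] _]]; exists a, b.
Qed.

(** Cancellation in the degrees makes the second factors agree in degree too, so both pairs fall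
    under one instance of [factorisation]. *)
Lemma factor_uniq a b a' b' : src a = rng b -> src a' = rng b' ->
  deg a = deg a' -> kcomp a b = kcomp a' b' -> a = a' /\ b = b'.
Proof.
move=> h h' da e.
have dl := deg_comp h; have dl' := deg_comp h'.
have db : deg b = deg b'.
  by apply: (@deg_addI _ (deg a)); rewrite -dl e dl' da.
have [p [_ pu]] := factorisation dl.
have e1 := pu (a, b) (And4 erefl erefl h erefl).
have e2 := pu (a', b') (And4 (esym da) (esym db) h' e).
by move: e1; rewrite e2 => -[].
Qed.

Lemma kcompI a b b' : src a = rng b -> src a = rng b' ->
  kcomp a b = kcomp a b' -> b = b'.
Proof. by move=> h h' /factor_uniq[]. Qed.

(** Composing [l] with an identity on either side gives two factorisations of [l] whose first
    factors have degree 0. *)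
Lemma deg0_id l : deg l = 0 -> l = kid (rng l).
Proof.
move=> d; have [| | | |e _] := @factor_uniq l (kid (src l)) (kid (rng l)) l.
- by rewrite rng_id.
- by rewrite src_id.
- by rewrite deg_id.
- by rewrite comp_idl comp_idr.
- exact: e.
Qed.

Lemma comp_eq_rng a b a' b' : src a = rng b -> src a' = rng b' ->
  kcomp a b = kcomp a' b' -> rng a = rng a'.
Proof. by move=> h h' e; rewrite -(rng_comp h) e rng_comp. Qed.

(** The terminal condition in [paths_le]: where the degree of a path falls short, that direction is
    dead at its source. *)
Definition dead v (i : 'I_k) := paths_from v (unit_deg i) = set0.

Lemma not_dead v i l : rng l = v -> (0 < deg l ord0 i)%N -> ~ dead v i.
Proof.
move=> rl di D.
have [|a [b [da db ab e]]] := @factor l (unit_deg i) (sub_deg (deg l) (unit_deg i)).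
  by rewrite subdegK // => j; rewrite unit_degE; case: eqP => // ->.
have : paths_from v (unit_deg i) a by split=> //; rewrite -rl e rng_comp.
by rewrite D.
Qed.

Lemma dead_src l i : dead (rng l) i -> dead (src l) i.
Proof.
move=> D; apply/seteqP; split=> // m [rm dm]; exfalso.
apply: (@not_dead (rng l) i (kcomp l m) _ _ D); first by rewrite rng_comp.
by rewrite deg_comp // addrVE dm unit_degE eqxx; lia.
Qed.

(** Local convexity enters here: an edge of degree $e_i$ at a vertex survives along any edge of
    another direction. Induction on the total degree, peeling off the first edge, carries deadness
    back from the source of [l] to its range. *)
Lemma alive_src l i : deg l ord0 i = 0 -> dead (src l) i -> dead (rng l) i.
Proof.
have [N le_N] := ubnP (\sum_j deg l ord0 j)%N; elim: N => // N IH in l le_N *.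
move=> di D.
have [d0|/existsP[j dj]] := altP (@forallP _ (fun j => deg l ord0 j == 0%N)).
  have -> : rng l = src l.
    rewrite (@deg0_id l) ?rng_id ?src_id //.
    by apply: degP => j; rewrite mxE; apply/eqP/d0.
  exact: D.
have ij : i <> j by move=> e; move: dj; rewrite -e di.
have [|a [b [da db ab e]]] := @factor l (unit_deg j) (sub_deg (deg l) (unit_deg j)).
  by rewrite subdegK // => j'; rewrite unit_degE; case: eqP => // ->; rewrite lt0n.
have Db : dead (rng b) i.
  apply: IH.
  - rewrite ltnS in le_N; apply: leq_trans le_N.
    rewrite (bigD1 j) //= [X in (_ < X)%N](bigD1 j) //= db sub_degE unit_degE eqxx.
    rewrite -addSn; apply: leq_add; first by rewrite subn1 prednK // lt0n.
    by apply: leq_sum => j' _; rewrite sub_degE leq_subr.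
  - by rewrite db sub_degE di.
  - by move: D; rewrite e src_comp.
apply: contrapT => /eqP/set0P[m [rm dm]].
rewrite e rng_comp // in rm.
have [[c hc] _] := @Lconv (rng a) j i a m (fun h => ij (esym h)) (conj erefl da) (conj rm dm).
by move: hc; rewrite ab Db.
Qed.

Lemma le_self l : paths_le (deg l) l.
Proof. by split=> [i|i]; rewrite ?ltnn. Qed.

Lemma le_id v : paths_le 0 (@kid k L v).
Proof. by split=> i; rewrite deg_id ?ltnn. Qed.

(** If [l] falls short in direction [i], then [i] is dead at [src l], hence at [src m]; otherwise
    the shortfall comes from [m]. *)
Lemma le_comp l m n n' : src l = rng m -> paths_le n l -> paths_le n' m ->
  paths_le (n + n') (kcomp l m).
Proof.
move=> lm [h1 h2] [h3 h4]; split=> i; rewrite deg_comp // !addrVE.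
  exact: leq_add.
rewrite src_comp // => h.
have [h5|h5] := ltnP (deg l ord0 i) (n ord0 i).
  by apply: dead_src; rewrite -lm; apply: h2.
by apply: h4; lia.
Qed.

(** Where [a] falls short of [n], the direction is dead at [src a], so [b] adds nothing to it. Hence
    the whole path determines its prefix in $\Lambda^{\leq n}$. *)
Lemma le_prefix_deg a b n : src a = rng b -> paths_le n a ->
  deg a = min_deg (deg (kcomp a b)) n.
Proof.
move=> ab [h1 h2]; apply: degP => i; rewrite min_degE deg_comp // addrVE.
have := h1 i; have [h|h] := ltnP (deg a ord0 i) (n ord0 i); last by lia.
have [|d] := posnP (deg b ord0 i); first by lia.
by case: (@not_dead (src a) i b (esym ab) d); apply: h2.
Qed.

Lemma le_prefix_uniq a b a' b' n : src a = rng b -> src a' = rng b' ->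
  paths_le n a -> paths_le n a' -> kcomp a b = kcomp a' b' -> a = a' /\ b = b'.
Proof.
move=> h h' la la' e; apply: factor_uniq => //.
by rewrite (le_prefix_deg h la) (le_prefix_deg h' la') e.
Qed.

(** The cut is made at degree $\min(d(l),n)$. Where the first piece falls short of [n], the second
    has degree 0, and [alive_src] moves deadness from [src l] back to the cut. *)
Lemma le_factor l n n' : paths_le (n + n') l ->
  exists a b, [/\ paths_le n a, paths_le n' b, src a = rng b & l = kcomp a b].
Proof.
move=> [h1 h2].
have [|a [b [da db ab e]]] := @factor l (min_deg (deg l) n) (sub_deg (deg l) (min_deg (deg l) n)).
  by rewrite subdegK // => i; rewrite min_degE geq_minl.
exists a, b; split=> //; split=> i.
- by rewrite da min_degE geq_minr.
- rewrite da min_degE => h; rewrite ab; apply: alive_src.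
    by rewrite db sub_degE min_degE; lia.
  by have := h2 i; rewrite e src_comp //; apply; rewrite -e addrVE; lia.
- by rewrite db sub_degE min_degE; have := h1 i; rewrite addrVE; lia.
- rewrite db sub_degE min_degE => h.
  by have := h2 i; rewrite e src_comp //; apply; rewrite -e addrVE; lia.
Qed.

Hypothesis Lrf : row_finite L.

Lemma finite_le_from v n : finite_set (paths_le_from v n).
Proof.
pose X : set 'rV[nat]_k := [set m | deg_le m n].
have fX : finite_set X.
  pose g (f : {ffun 'I_k -> 'I_(\max_i n ord0 i).+1}) : 'rV[nat]_k := \row_i (f i : nat).
  apply: (@sub_finite_set _ _ (g @` setT)); last exact/finite_image/finite_finset.
  move=> m mn; exists [ffun i => inord (m ord0 i)] => //.
  apply: degP => i; rewrite mxE ffunE inordK // ltnS.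
  exact: leq_trans (mn i) (leq_bigmax i).
apply: (@sub_finite_set _ _ (\bigcup_(m in X) paths_from v m)).
  by move=> l [rl [dl _]]; exists (deg l).
by apply: bigcup_finite.
Qed.

End Paths.

(** * Submodules and ideals *)

Section Submodules.
Variables (R : comNzRingType) (V : lmodType R).
Implicit Types (U X : set V).

Lemma submodule_sum (I : eqType) (s : seq I) (F : I -> V) U :
  is_submodule U -> (forall i, i \in s -> U (F i)) -> U (\sum_(i <- s) F i).
Proof.
move=> [h0 hD _]; elim: s => [|i s IH] h; first by rewrite big_nil.
rewrite big_cons; apply: hD; first by apply: h; rewrite mem_head.
by apply: IH => j js; apply: h; rewrite inE js orbT.
Qed.

Lemma lspan_submodule X : is_submodule (lspan X).
Proof.
split=> [U [[h0 hD hZ] _] //|x y hx hy U [hU XU]|a x hx U [hU XU]].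
- by case: (hU) => _ hD _; apply: hD; [apply: hx|apply: hy].
- by case: (hU) => _ _ hZ; apply: hZ; apply: hx.
Qed.

Lemma sub_lspan X : X `<=` lspan X.
Proof. by move=> x Xx U [_]; apply. Qed.

Lemma lspan_min X U : is_submodule U -> X `<=` U -> lspan X `<=` U.
Proof. by move=> hU XU x; apply. Qed.

Lemma linear_preim_submodule (W : lmodType R) (f : {linear V -> W}) (U : set W) :
  is_submodule U -> is_submodule (f @^-1` U).
Proof.
move=> [h0 hD hZ]; split=> [|x y hx hy|a x hx] /=.
- by rewrite linear0.
- by rewrite linearD; apply: hD.
- by rewrite linearZ; apply: hZ.
Qed.

Section SubType.
Variables (U : set V) (hU : is_submodule U).

(* The unused proof argument lets the closedness instance below be inferred. *)
Definition submodule_pred of is_submodule U : pred V := fun x => x \in U.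

Lemma submodule_pred_closed : submod_closed (submodule_pred hU).
Proof.
case: (hU) => h0 hD hZ; split; first exact/mem_set.
by move=> a x y /set_mem hx /set_mem hy; apply/mem_set/hD => //; apply: hZ.
Qed.

HB.instance Definition _ :=
  GRing.isSubmodClosed.Build R V (submodule_pred hU) submodule_pred_closed.

Record submodule_type := SubmoduleElt
  { submodule_val :> V; _ : submodule_val \in submodule_pred hU }.

HB.instance Definition _ := [isSub for submodule_val].
HB.instance Definition _ := [Choice of submodule_type by <:].
HB.instance Definition _ := [SubChoice_isSubLmodule of submodule_type by <:].

Lemma submodule_valP (x : submodule_type) : U (submodule_val x).
Proof. by case: x => x /= /set_mem. Qed.

Definition to_submodule x (Ux : U x) : submodule_type := SubmoduleElt (mem_set Ux).

Lemma submodule_val_linear : linear submodule_val.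
Proof. by []. Qed.

HB.instance Definition _ :=
  GRing.isLinear.Build R submodule_type V *:%R submodule_val submodule_val_linear.

Variable (mul : V -> V -> V).
Hypothesis mulU : forall x y, U x -> U y -> U (mul x y).
Hypothesis mulA : forall x y z, U x -> U y -> U z ->
  mul x (mul y z) = mul (mul x y) z.
Hypothesis mulDl : forall x y z, U x -> U y -> U z ->
  mul (x + y) z = mul x z + mul y z.
Hypothesis mulDr : forall x y z, U x -> U y -> U z ->
  mul x (y + z) = mul x y + mul x z.
Hypothesis mulZl : forall a x y, U x -> U y -> mul (a *: x) y = a *: mul x y.
Hypothesis mulZr : forall a x y, U x -> U y -> mul x (a *: y) = a *: mul x y.

Definition submodule_mul (x y : submodule_type) : submodule_type :=
  to_submodule (mulU (submodule_valP x) (submodule_valP y)).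

(** The laws of [mul] are asked on [U] only, so that composition of functions qualifies: it is
    additive on the right just for additive maps. *)
Definition submodule_nualg : nualg R.
Proof.
refine (@NuAlg R submodule_type submodule_mul _ _ _ _ _).
- by move=> x y z; apply: val_inj; apply: mulA; apply: submodule_valP.
- by move=> x y z; apply: val_inj; apply: mulDl; apply: submodule_valP.
- by move=> x y z; apply: val_inj; apply: mulDr; apply: submodule_valP.
- by move=> a x y; apply: val_inj; apply: mulZl; apply: submodule_valP.
- by move=> a x y; apply: val_inj; apply: mulZr; apply: submodule_valP.
Defined.

End SubType.
End Submodules.

(** * Two-sided ideals *)

Section Ideals.
Variables (R : comNzRingType) (A : nualg R).
Implicit Types (X I : set A).
Local Open Scope nualg_scope.

Lemma amul0l (x : A) : 0 ** x = 0.
Proof. by rewrite -{1}(scale0r 0) amulZl scale0r. Qed.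

Lemma amul0r (x : A) : x ** 0 = 0.
Proof. by rewrite -{1}(scale0r 0) amulZr scale0r. Qed.

Lemma amul_suml (I : Type) (s : seq I) (F : I -> A) x :
  (\sum_(i <- s) F i) ** x = \sum_(i <- s) F i ** x.
Proof.
elim: s => [|i s IH]; first by rewrite !big_nil amul0l.
by rewrite !big_cons amulDl IH.
Qed.

Lemma amul_sumr (I : Type) (s : seq I) (F : I -> A) x :
  x ** (\sum_(i <- s) F i) = \sum_(i <- s) x ** F i.
Proof.
elim: s => [|i s IH]; first by rewrite !big_nil amul0r.
by rewrite !big_cons amulDr IH.
Qed.

Lemma mulr_submodule (a : A) I : is_submodule I -> is_submodule [set x | I (a ** x)].
Proof.
move=> [h0 hD hZ]; split=> [|x y hx hy|c x hx] /=; first by rewrite amul0r.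
- by rewrite amulDr; apply: hD.
- by rewrite amulZr; apply: hZ.
Qed.

Lemma mull_submodule (a : A) I : is_submodule I -> is_submodule [set x | I (x ** a)].
Proof.
move=> [h0 hD hZ]; split=> [|x y hx hy|c x hx] /=; first by rewrite amul0l.
- by rewrite amulDl; apply: hD.
- by rewrite amulZl; apply: hZ.
Qed.

Lemma ideal_generated_ideal X : is_ideal (ideal_generated X).
Proof.
split; first split.
- by move=> U [[[]]].
- move=> x y hx hy U [hU XU]; case: (hU) => [[_ hD _] _].
  by apply: hD; [apply: hx|apply: hy].
- by move=> a x hx U [hU XU]; case: (hU) => [[_ _ hZ] _]; apply: hZ; apply: hx.
- by move=> a x hx; split=> U [hU XU]; case: (hU) => [_ h];
    have [] := h a x (hx U (conj hU XU)).
Qed.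

Lemma sub_ideal_generated X : X `<=` ideal_generated X.
Proof. by move=> x Xx U [_]; apply. Qed.

Lemma ideal_generated_min X I : is_ideal I -> X `<=` I -> ideal_generated X `<=` I.
Proof. by move=> hI XI x; apply. Qed.

End Ideals.

Lemma kernel_ideal (R : comNzRingType) (A B : nualg R) (f : {linear A -> B}) :
  multiplicative_map f -> is_ideal (f @^-1` [set 0]).
Proof.
move=> fM; split.
  apply: linear_preim_submodule; split=> //.
  - by move=> x y -> ->; rewrite addr0.
  - by move=> a x ->; rewrite scaler0.
move=> a x /= fx; by split; rewrite /= fM fx ?amul0l ?amul0r.
Qed.

(** * The algebra of linear endomorphisms *)

Section Endomorphisms.
Variables (R : comNzRingType) (V : lmodType R).

Definition endo_set : set (V -> V) :=
  [set f | forall (a : R) x y, f (a *: x + y) = a *: f x + f y].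

Lemma endo_set_submodule : is_submodule endo_set.
Proof.
split=> [a x y|f g hf hg a x y|c f hf a x y].
- by rewrite /= scaler0 addr0.
- rewrite -[LHS]/(f (a *: x + y) + g (a *: x + y)).
  rewrite -[RHS]/(a *: (f x + g x) + (f y + g y)) hf hg scalerDr; exact: addrACA.
- rewrite -[LHS]/(c *: f (a *: x + y)) -[RHS]/(a *: (c *: f x) + c *: f y).
  rewrite hf scalerDr !scalerA; congr (_ *: _ + _).
  exact: mulrC.
Qed.

Lemma endoD f x y : endo_set f -> f (x + y) = f x + f y.
Proof. by move=> hf; rewrite -[x]scale1r hf !scale1r. Qed.

Lemma endo0 f : endo_set f -> f 0 = 0.
Proof.
by move=> hf; apply: (@addIr _ (f 0)); rewrite -endoD // addr0 add0r.
Qed.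

Lemma endoZ f a x : endo_set f -> f (a *: x) = a *: f x.
Proof. by move=> hf; rewrite -[a *: x]addr0 hf endo0 // addr0. Qed.

Lemma endo_comp f g : endo_set f -> endo_set g -> endo_set (f \o g).
Proof. by move=> hf hg a x y /=; rewrite hg hf. Qed.

Definition endo_nualg : nualg R.
Proof.
refine (@submodule_nualg R (V -> V) endo_set endo_set_submodule
  (fun f g => f \o g) endo_comp _ _ _ _ _) => //.
- by move=> f g h hf hg hh; apply/funext => x; rewrite /= [(g + h) x]/(g x + h x) endoD.
- by move=> a f g hf hg; apply/funext => x; rewrite /= [(a *: g) x]/(a *: g x) endoZ.
Defined.

End Endomorphisms.

(** * Products in Kumjian-Pask algebras *)

Section Products.
Variables (k : nat) (hk : (0 < k)%N) (L : kgraph k).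
Hypotheses (Lrf : row_finite L) (Lconv : locally_convex L).

Definition le_seq v n : seq (kpath L) :=
  fset_set (paths_le_from v n).

Lemma le_seq_uniq v n : uniq (le_seq v n).
Proof. exact: fset_uniq. Qed.

Lemma mem_le_seq v n l : (l \in le_seq v n) <-> (rng l = v /\ paths_le n l).
Proof.
have -> : (l \in le_seq v n) = (l \in paths_le_from v n).
  by rewrite -(in_fset_set (finite_le_from Lrf v n)).
by rewrite in_setE.
Qed.

Lemma fsum_le_seq (V : nmodType) v n (F : kpath L -> V) :
  \sum_(l \in paths_le_from v n) F l = \sum_(l <- le_seq v n) F l.
Proof. exact/fsbig_finite/finite_le_from. Qed.

(** Adding the all-ones vector is how the nonzero degrees demanded by [kp3] and [kp4] are reached
    below. *)
Lemma addr1_neq0 (n : 'rV[nat]_k) : n + const_mx 1%N <> 0.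
Proof. by move=> /rowP/(_ (Ordinal hk)); rewrite !mxE; lia. Qed.

Variables (R : comNzRingType) (A : nualg R) (p : kp_family L A).
Local Open Scope nualg_scope.
Notation S := (kpS p).
Notation T := (kpT p).
Notation P := (kpP p).

Lemma kp4_seq v n : n <> 0 -> P v = \sum_(l <- le_seq v n) S l ** T l.
Proof. by move=> n0; rewrite -fsum_le_seq; apply: kp4. Qed.

(** Inserting vertex idempotents between the factors exposes a product $p_vp_w$ with $v\neq w$,
    which [kp1] kills. *)
Lemma kpS_neq l m : src l <> rng m -> S l ** S m = 0.
Proof.
move=> h; rewrite -(kp2SP p l) -(kp2PS p m) -amulA (amulA (P _)) kp1.
by move/eqP/negbTE: h => ->; rewrite amul0l amul0r.
Qed.

Lemma kpT_neq l m : src l <> rng m -> T m ** T l = 0.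
Proof.
move=> h; rewrite -(kp2PT p l) -(kp2TP p m) -amulA (amulA (P _)) kp1.
by rewrite eq_sym; move/eqP/negbTE: h => ->; rewrite amul0l amul0r.
Qed.

Lemma kpST_neq l m : src l <> src m -> S l ** T m = 0.
Proof.
move=> h; rewrite -(kp2SP p l) -(kp2PT p m) -amulA (amulA (P _)) kp1.
by move/eqP/negbTE: h => ->; rewrite amul0l amul0r.
Qed.

(** [kp3] covers nonzero degree; a path of degree 0 is an identity and is left to [kp1]. *)
Lemma kpTS l : T l ** S l = P (src l).
Proof.
have [d0|/eqP d0] := eqVneq (deg l) 0; last first.
  by rewrite (kp3 _ d0) ?eqxx //; apply: le_self.
by rewrite (deg0_id d0) kpS_id kpT_id src_id kp1 eqxx.
Qed.

Lemma kpTS_deg l m : deg l = deg m -> T l ** S m = P (src l) *+ (l == m).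
Proof.
move=> e; have [d0|/eqP d0] := eqVneq (deg l) 0; last first.
  by rewrite (kp3 _ d0) //; [apply: le_self|rewrite e; apply: le_self].
have lE := deg0_id d0; rewrite e in d0; have mE := deg0_id d0.
rewrite lE mE kpS_id kpT_id src_id kp1; congr (_ *+ nat_of_bool _).
by apply/eqP/eqP => [->|/(congr1 (@rng _ _))] //; rewrite !rng_id.
Qed.

Lemma kpS_expand m n : n <> 0 ->
  S m = \sum_(l <- le_seq (src m) n) S (kcomp m l) ** T l.
Proof.
move=> n0; rewrite -{1}(kp2SP p m) (kp4_seq _ n0) amul_sumr.
rewrite big_seq [RHS]big_seq; apply: eq_bigr => l /mem_le_seq[rl _].
by rewrite amulA kp2S.
Qed.

Lemma kpT_expand m n : n <> 0 ->
  T m = \sum_(l <- le_seq (src m) n) S l ** T (kcomp m l).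
Proof.
move=> n0; rewrite -{1}(kp2PT p m) (kp4_seq _ n0) amul_suml.
rewrite big_seq [RHS]big_seq; apply: eq_bigr => l /mem_le_seq[rl _].
by rewrite -amulA kp2T.
Qed.

(** Inserting (KP4') at the common source lengthens both paths by the same [l], which preserves the
    difference of degrees. *)
Lemma kpST_expand a b n : n <> 0 -> src a = src b ->
  S a ** T b = \sum_(l <- le_seq (src a) n) S (kcomp a l) ** T (kcomp b l).
Proof.
move=> n0 ab; rewrite {1}(kpS_expand a n0) amul_suml.
rewrite big_seq [RHS]big_seq; apply: eq_bigr => l /mem_le_seq[rl _].
by rewrite -amulA kp2T // -ab.
Qed.

Lemma component_ST a b :
  kp_component p (zdeg (deg a) - zdeg (deg b)) (S a ** T b).
Proof. by apply: sub_lspan; exists a, b. Qed.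

Lemma component_submodule j : is_submodule (kp_component p j).
Proof. exact: lspan_submodule. Qed.

Lemma component0 j : kp_component p j 0.
Proof. by case: (component_submodule j). Qed.

(** Expanding both factors yields terms $s_x s_{(bx)^*} s_{my} s_{y^*}$ with $bx$ and $my$ in one
    common $\Lambda^{\leq n}$. By (KP3') only $bx=my$ survives, leaving $s_xs_{y^*}$, and this
    equality fixes its degree. *)
Lemma component_TS b m :
  kp_component p (zdeg (deg m) - zdeg (deg b)) (T b ** S m).
Proof.
have := component_submodule (zdeg (deg m) - zdeg (deg b)); set C := kp_component _ _ => hC.
rewrite (kpT_expand b (@addr1_neq0 (deg m))) (kpS_expand m (@addr1_neq0 (deg b))).
rewrite amul_suml; apply: submodule_sum => // x /mem_le_seq[rx lx].
rewrite amul_sumr; apply: submodule_sum => // y /mem_le_seq[ry ly].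
have lbx := le_comp (esym rx) (le_self b) lx.
have lmy := le_comp (esym ry) (le_self m) ly.
rewrite addrCA in lmy; rewrite -amulA (amulA (T _)).
rewrite (@kp3 _ _ _ _ p (deg b + (deg m + const_mx 1%N))) //; last first.
  by rewrite addrA; apply: addr1_neq0.
case: eqP => [e|_]; last by rewrite amul0l amul0r; case: hC.
rewrite src_comp // amulA kp2SP /C.
have /(congr1 (@zdeg k)) := congr1 (@deg _ _) e; rewrite !deg_comp // !zdegD => de.
suff -> : zdeg (deg m) - zdeg (deg b) = zdeg (deg x) - zdeg (deg y).
  exact: component_ST.
by apply/eqP; rewrite subr_eq addrAC eq_sym subr_eq addrC de.
Qed.

Lemma component_SxT a b j x : kp_component p j x ->
  kp_component p (zdeg (deg a) - zdeg (deg b) + j) (S a ** (x ** T b)).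
Proof.
have hC := component_submodule (zdeg (deg a) - zdeg (deg b) + j).
move: x; apply: lspan_min.
  exact: (mull_submodule (T b) (mulr_submodule (S a) hC)).
move=> _ [c [d [<- ->]]] /=.
rewrite -amulA amulA.
have [ac|/eqP ac] := eqVneq (src a) (rng c); last first.
  by rewrite kpS_neq // amul0l; exact: component0.
have [bd|/eqP bd] := eqVneq (src b) (rng d); last first.
  by rewrite kpT_neq // amul0r; exact: component0.
rewrite kp2S // kp2T // addrACA -opprD -!zdegD -!deg_comp //.
exact: component_ST.
Qed.

(** On spanning elements the inner product $s_{b^*}s_c$ is homogeneous by [component_TS];
    [component_SxT] then adds the outer factors. *)
Lemma component_mul i j x y : kp_component p i x -> kp_component p j y ->
  kp_component p (i + j) (x ** y).
Proof.
move=> hx hy; move: x hx; apply: lspan_min.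
  exact/mull_submodule/component_submodule.
move=> _ [a [b [<- ->]]] /=; move: y hy; apply: lspan_min.
  exact/mulr_submodule/component_submodule.
move=> _ [c [d [<- ->]]] /=.
have := @component_SxT a d _ _ (@component_TS b c).
rewrite !amulA [X in kp_component _ X _]addrACA [- _ + - _]addrC.
by rewrite -[X in kp_component _ X _]addrACA.
Qed.

Definition homogeneous : set A := \bigcup_j kp_component p j.

Lemma homogeneous_span_mul x y :
  lspan homogeneous x -> lspan homogeneous y -> lspan homogeneous (x ** y).
Proof.
move=> hx hy; have hC := lspan_submodule homogeneous.
move: x hx; apply: lspan_min; first exact/mull_submodule.
move=> x [i _ hx] /=; move: y hy; apply: lspan_min; first exact/mulr_submodule.
move=> y [j _ hy] /=; apply: sub_lspan; exists (i + j) => //.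
exact: component_mul.
Qed.

Lemma homogeneous_ST a b : homogeneous (S a ** T b).
Proof. by exists (zdeg (deg a) - zdeg (deg b)) => //; apply: component_ST. Qed.

Lemma homogeneous_S a : homogeneous (S a).
Proof.
by have := homogeneous_ST a (kid (src a)); rewrite kpT_id kp2SP.
Qed.

Lemma homogeneous_T a : homogeneous (T a).
Proof.
by have := homogeneous_ST (kid (src a)) a; rewrite kpS_id kp2PT.
Qed.

Lemma homogeneous_P v : homogeneous (P v).
Proof. by rewrite -kpS_id; apply: homogeneous_S. Qed.

End Products.

(** * The grading *)

(** Repeated generators are merged so that a single coefficient can later be isolated. *)
Lemma lspan_repr (R : comNzRingType) (V : lmodType R) (I : eqType)
    (D : I -> Prop) (F : I -> V) x :
  lspan [set y | exists i, D i /\ y = F i] x ->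
  exists (s : seq I) (c : I -> R),
    [/\ uniq s, forall i, i \in s -> D i & x = \sum_(i <- s) c i *: F i].
Proof.
move=> hx.
have [s [Ds ->]] : exists s : seq (R * I),
    (forall i, i \in s -> D i.2) /\ x = \sum_(i <- s) i.1 *: F i.2.
  move: x hx; apply: lspan_min; last first.
    move=> _ [i [Di ->]]; exists [:: (1, i)]; split=> [j|].
      by rewrite inE => /eqP ->.
    by rewrite big_seq1 scale1r.
  split=> [|x y [s [Ds ->]] [t [Dt ->]]|a x [s [Ds ->]]].
  - by exists [::]; rewrite big_nil.
  - exists (s ++ t); rewrite big_cat; split=> // i.
    by rewrite mem_cat => /orP[/Ds|/Dt].
  - exists [seq (a * i.1, i.2) | i <- s]; split=> [i /mapP[j /Ds Dj ->] //|].
    by rewrite big_map scaler_sumr; apply: eq_bigr => i _; rewrite scalerA.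
exists (undup [seq i.2 | i <- s]), (fun q => \sum_(i <- s | i.2 == q) i.1).
split; first exact: undup_uniq.
  by move=> i; rewrite mem_undup => /mapP[j /Ds Dj ->].
rewrite /=; under [RHS]eq_bigr => q _ do rewrite scaler_suml.
rewrite (exchange_big_dep predT) //= big_seq [RHS]big_seq.
apply: eq_bigr => i si; rewrite -big_filter.
(* Each entry of [s] contributes to exactly one index of the duplicate-free list. *)
rewrite (_ : [seq q <- _ | _] = [:: i.2]) ?big_seq1 //.
rewrite -[RHS](@filter_pred1_uniq _ (undup [seq i.2 | i <- s])) ?undup_uniq //.
  by apply: eq_filter => q; rewrite /= eq_sym.
by rewrite mem_undup; apply/mapP; exists i.
Qed.

Section Grading.
Variables (k : nat) (hk : (0 < k)%N) (L : kgraph k).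
Hypotheses (Lrf : row_finite L) (Lconv : locally_convex L).
Variables (R : comNzRingType) (A : nualg R) (p : kp_family L A).
Local Open Scope nualg_scope.
Notation S := (kpS p).
Notation T := (kpT p).
Notation P := (kpP p).

Definition homogeneous_nualg : nualg R :=
  submodule_nualg (lspan_submodule (homogeneous p))
    (@homogeneous_span_mul k hk L Lrf R A p)
    (fun x y z _ _ _ => amulA x y z)
    (fun x y z _ _ _ => amulDl x y z)
    (fun x y z _ _ _ => amulDr x y z)
    (fun a x y _ _ => amulZl a x y)
    (fun a x y _ _ => amulZr a x y).

(** The family [p] seen inside the span of the homogeneous elements, as a target for the universal
    property. *)
Definition subfamily : kp_family L homogeneous_nualg.
Proof.
pose sub x (h : homogeneous p x) : homogeneous_nualg :=
  to_submodule (lspan_submodule (homogeneous p)) (sub_lspan h).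
refine (@KPFamily k L R homogeneous_nualg (fun v => sub _ (homogeneous_P p v))
  (fun l => sub _ (homogeneous_S p l)) (fun l => sub _ (homogeneous_T p l))
  _ _ _ _ _ _ _ _ _ _ _).
- by move=> v; apply: val_inj; apply: kpS_id.
- by move=> v; apply: val_inj; apply: kpT_id.
- move=> v w; apply: val_inj; rewrite raddfMn /= /submodule_mul /=; exact: kp1.
- by move=> l m lm; apply: val_inj; apply: kp2S.
- by move=> l m lm; apply: val_inj; apply: kp2T.
- by move=> l; apply: val_inj; apply: kp2PS.
- by move=> l; apply: val_inj; apply: kp2SP.
- by move=> l; apply: val_inj; apply: kp2PT.
- by move=> l; apply: val_inj; apply: kp2TP.
- move=> n l m n0 ln mn; apply: val_inj; rewrite raddfMn /= /submodule_mul /=; exact: (@kp3 _ _ _ _ p n).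
- move=> v n n0; apply: val_inj; rewrite fsum_le_seq // raddf_sum /=.
  exact: kp4_seq.
Defined.

Hypothesis p_universal : universal_kp_family p.

(** Universality maps [A] into the span; followed by the inclusion this fixes the family, so by
    uniqueness it is the identity. *)
Lemma kp_span x : lspan (homogeneous p) x.
Proof.
have [f [[fM fP fS fT] _]] := p_universal subfamily.
have [g [_ gU]] := p_universal p.
pose h : {linear A -> A} := @submodule_val _ _ _ _ \o f.
have <- : h x = x.
  have hid : kp_morphism p p (idfun : {linear A -> A}) by split.
  rewrite -(gU h); first exact: (gU _ hid).
  by split=> [y z|v|l|l] /=; rewrite ?fM ?fP ?fS ?fT.
exact: submodule_valP.
Qed.

(** The homogeneous elements span the algebra, so the span [K] of the homogeneous elements of [J] is
    an ideal. It contains the generators, hence all of [J]. *)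
Lemma ideal_generated_graded (G : set (vertex L)) :
  graded_ideal p (ideal_generated (P @` G)).
Proof.
set J := ideal_generated _; have hJ : is_ideal J := ideal_generated_ideal _.
split=> //; apply/seteqP; split; last first.
  by apply: lspan_min; [case: hJ|move=> x [j _ []]].
set K := lspan _; have hK : is_submodule K := lspan_submodule _.
apply: ideal_generated_min; last first.
  move=> _ [v Gv <-]; have [j _ hj] := homogeneous_P p v.
  by apply: sub_lspan; exists j => //; split=> //; apply: sub_ideal_generated; exists v.
split=> // a x Kx; split.
- move: a (kp_span a); apply: lspan_min; first exact: mull_submodule.
  move=> a [i _ ha]; move: x Kx; apply: lspan_min; first exact: mulr_submodule.
  move=> x [j _ [Jx hx]]; apply: sub_lspan; exists (i + j) => //; split.
    by case: hJ => _ /(_ a _ Jx)[].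
  exact: component_mul.
- move: a (kp_span a); apply: lspan_min; first exact: mulr_submodule.
  move=> a [i _ ha]; move: x Kx; apply: lspan_min; first exact: mull_submodule.
  move=> x [j _ [Jx hx]]; apply: sub_lspan; exists (j + i) => //; split.
    by case: hJ => _ /(_ a _ Jx)[].
  exact: component_mul.
Qed.

End Grading.

(** * Graded ideals and hereditary saturated sets *)

Section VertexSet.
Variables (k : nat) (hk : (0 < k)%N) (L : kgraph k).
Hypotheses (Lrf : row_finite L) (Lconv : locally_convex L).
Variables (R : comNzRingType) (A : nualg R) (p : kp_family L A).
Local Open Scope nualg_scope.
Notation S := (kpS p).
Notation T := (kpT p).
Notation P := (kpP p).

(** This rests on $p_{s(l)}=s_{l^*}p_{r(l)}s_l$. *)
Lemma hereditary_vertex_set I : is_ideal I -> hereditary (P @^-1` I).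
Proof.
move=> [_ hI] l /= hl; rewrite -kpTS -(kp2PS p l) amulA.
by apply: (hI (S l) _ _).2; apply: (hI (T l) _ hl).1.
Qed.

Lemma unit_deg_neq0 (i : 'I_k) : unit_deg i <> 0.
Proof. by move=> /rowP/(_ i); rewrite unit_degE mxE eqxx. Qed.

(** (KP4') at $e_i$ reads $p_v=\sum s_lp_{s(l)}s_{l^*}$ over $l\in v\Lambda^{\leq e_i}$. *)
Lemma saturated_vertex_set I : is_ideal I -> saturated (P @^-1` I).
Proof.
move=> [sI hI] v [i hi] /=; rewrite (kp4_seq Lrf p v (@unit_deg_neq0 i)).
apply: submodule_sum => // l /(mem_le_seq Lrf) hl.
rewrite -(kp2SP p l); apply: (hI (T l) _ _).2; apply: (hI (S l) _ _).1.
by apply: hi; exists l.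
Qed.

(** Only second paths are placed in $\Lambda^{\leq n}$; fixing [j] forces first paths to agree in
    degree when the second ones coincide. *)
Definition homog_pairs (n : 'rV[nat]_k) j (q : kpath L * kpath L) : Prop :=
  [/\ zdeg (deg q.1) - zdeg (deg q.2) = j, src q.1 = src q.2 & paths_le n q.2].

Lemma component_repr j x : kp_component p j x ->
  exists n : 'rV[nat]_k, n <> 0 /\
    lspan [set y | exists q, homog_pairs n j q /\ y = S q.1 ** T q.2] x.
Proof.
pose X n := lspan [set y | exists q, homog_pairs n j q /\ y = S q.1 ** T q.2].
have hX n : is_submodule (X n) by exact: lspan_submodule.
(* The claim is strengthened to all degrees above a bound, so that two summands can be expanded at
   the same degree. *)
move=> hx; suff [N hN] : exists N, forall n, X (N + n + const_mx 1%N) x.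
  by exists (N + 0 + const_mx 1%N); split; [exact: addr1_neq0|exact: hN].
move: x hx; apply: lspan_min; first split.
- by exists 0 => n; case: (hX (0 + n + const_mx 1%N)).
- move=> x y [N hN] [M hM]; exists (N + M) => n.
  case: (hX (N + M + n + const_mx 1%N)) => _ hD _; apply: hD.
    by rewrite -[N + M + n]addrA.
  by rewrite [N + M]addrC -[M + N + n]addrA.
- move=> a x [N hN]; exists N => n.
  by case: (hX (N + n + const_mx 1%N)) => _ _ hZ; apply: hZ.
(* Lengthening [b] by a path of $\Lambda^{\leq n+1}$, with 1 the all-ones vector, lands in
   $\Lambda^{\leq d(b)+n+1}$. *)
move=> _ [a [b [dj ->]]]; exists (deg b) => n.
have [ab|/eqP ab] := eqVneq (src a) (src b); last first.
  by rewrite kpST_neq //; case: (hX (deg b + n + const_mx 1%N)).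
rewrite (kpST_expand Lrf p (@addr1_neq0 _ hk n) ab).
apply: submodule_sum => // l /(mem_le_seq Lrf)[rl ll].
apply: sub_lspan; exists (kcomp a l, kcomp b l); split=> //; split=> /=.
- by rewrite -dj !deg_comp -?ab // !zdegD opprD addrACA subrr addr0.
- by rewrite !src_comp -?ab.
- by rewrite -addrA; apply: le_comp => //; [rewrite -ab|apply: le_self].
Qed.

(** [kp3] kills the terms with second path other than [q.2]. In the rest the first path has the
    degree of [q.1], so [kpTS_deg] leaves only [q]. *)
Lemma kp_coefficient n j (s : seq (kpath L * kpath L)) (c : kpath L * kpath L -> R) q :
  n <> 0 -> uniq s -> (forall q, q \in s -> homog_pairs n j q) -> q \in s ->
  T q.1 ** (\sum_(i <- s) c i *: (S i.1 ** T i.2)) ** S q.2 = c q *: P (src q.1).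
Proof.
move=> n0 us hs qs; have [dq srcq leq] := hs q qs.
rewrite amul_sumr amul_suml (bigD1_seq q) //= big_seq_cond big1 ?addr0.
  rewrite amulZr amulZl !amulA kpTS -amulA kpTS srcq kp1 eqxx //.
move=> i /andP[/hs[di srci lei] iq]; rewrite amulZr amulZl !amulA -amulA.
rewrite (kp3 p n0 lei leq); case: eqP => [e2|_]; last by rewrite mulr0n amul0r scaler0.
have e1 : deg q.1 = deg i.1.
  by apply: zdeg_inj; move/eqP: di; rewrite -dq e2 => /eqP/addIr.
rewrite mulr1n -srci -amulA kp2SP kpTS_deg //; case: eqP => [e|_]; last by rewrite scaler0.
by move: iq; rewrite -pair_eqE /pair_eq /= e2 e !eqxx.
Qed.

Lemma graded_basic_ideal_eq I : graded_ideal p I -> basic_ideal p I ->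
  I = ideal_generated (P @` (P @^-1` I)).
Proof.
move=> [[sI hI] gI] [_ bI]; set J := ideal_generated _.
have [sJ hJ] : is_ideal J := ideal_generated_ideal _.
apply/seteqP; split; last by apply: ideal_generated_min => // _ [v hv <-].
rewrite gI; apply: lspan_min => // x [j _ [Ix /component_repr[n [n0]]]].
move=> /lspan_repr[s [c [us hs xE]]]; rewrite xE.
apply: submodule_sum => // q qs.
have [->|/eqP cq] := eqVneq (c q) 0; first by rewrite scale0r; case: sJ.
have Iq : I (P (src q.1)).
  apply: (bI _ _ cq); rewrite -(kp_coefficient c n0 us hs qs) -xE.
  by apply: (hI (S q.2) _ _).2; apply: (hI (T q.1) _ Ix).1.
case: sJ => _ _; apply; rewrite -(kp2SP p q.1).
apply: (hJ (T q.2) _ _).2; apply: (hJ (S q.1) _ _).1.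
by apply: sub_ideal_generated; exists (src q.1).
Qed.

End VertexSet.

(** * The boundary path representation *)

Section WeightedComposition.
Variables (R : comNzRingType) (X : Type).
Notation V := (X -> R^o).

(** The operator $f\mapsto 1_D\cdot(f\circ h)$; composing operators composes the underlying maps in
    reverse order. *)
Definition wcomp (D : set X) (h : X -> X) (f : V) : V :=
  fun x => if `[< D x >] then f (h x) else 0.

Lemma wcomp_endo D h : @endo_set R V (wcomp D h).
Proof.
move=> a f g; apply/funext => x.
rewrite -[RHS]/(a *: wcomp D h f x + wcomp D h g x) /wcomp.
by case: asboolP => // _; rewrite scaler0 addr0.
Qed.

Lemma wcomp_comp D h D' h' :
  wcomp D h \o wcomp D' h' = wcomp [set x | D x /\ D' (h x)] (h' \o h).
Proof.
apply/funext => f; apply/funext => x; rewrite /wcomp /=.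
by rewrite asbool_and; case: `[< D x >].
Qed.

Lemma eq_wcomp D h D' h' : (forall x, D x <-> D' x) ->
  (forall x, D x -> h x = h' x) -> wcomp D h = wcomp D' h'.
Proof.
move=> hD hh; apply/funext => f; apply/funext => x; rewrite /wcomp.
by case: asboolP => [/[dup] /hh -> /hD|] Dx; case: asboolP => // /hD.
Qed.

Lemma wcomp_empty D h : (forall x, ~ D x) -> wcomp D h = 0.
Proof.
move=> hD; apply/funext => f; apply/funext => x; rewrite /wcomp.
by case: asboolP => // /hD.
Qed.

End WeightedComposition.

(** * Boundary paths avoiding a hereditary saturated set *)

Section BoundaryPaths.
Variables (k : nat) (L : kgraph k).
Hypotheses (Lrf : row_finite L) (Lconv : locally_convex L).
Variable G : set (vertex L).
Hypotheses (hG : hereditary G) (sG : saturated G).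
Implicit Types (U : set (kpath L)) (a b c l m : kpath L) (n : 'rV[nat]_k).

(* A boundary path with all its vertices outside G is encoded as the set of its
   initial segments. *)
Record bpath U : Prop := BPath {
  bpath_prefix : forall a b, src a = rng b -> U (kcomp a b) -> U a;
  bpath_directed : forall a b, U a -> U b -> exists c d,
    [/\ src a = rng c, src b = rng d, kcomp a c = kcomp b d & U (kcomp a c)];
  bpath_meets : forall n, exists a, paths_le n a /\ U a;
  bpath_avoids : forall a, U a -> ~ G (src a)
}.

Definition bshift l U := [set m | src l = rng m /\ U (kcomp l m)].

(** Prepending [l]: the prefixes of the paths $lm$ are included, as those paths alone are not closed
    under taking prefixes. *)
Definition bext l U := [set a | exists b m,
  [/\ src a = rng b, src l = rng m, U m & kcomp a b = kcomp l m]].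

Lemma kcomp_id l v : src l = v -> kcomp l (kid v) = l.
Proof. by move=> <-; rewrite comp_idr. Qed.

Lemma id_kcomp l v : rng l = v -> kcomp (kid v) l = l.
Proof. by move=> <-; rewrite comp_idl. Qed.

Lemma bpath_rng U a b : bpath U -> U a -> U b -> rng a = rng b.
Proof.
by move=> hU Ua Ub; have [c [d [ac bd e _]]] := bpath_directed hU Ua Ub; apply: comp_eq_rng e.
Qed.

Lemma bpath_id U l : bpath U -> U l -> U (kid (rng l)).
Proof.
move=> hU Ul; apply: (bpath_prefix hU (b := l)); first by rewrite src_id.
by rewrite comp_idl.
Qed.

Lemma bpath_id_rng U l v : bpath U -> U (kid v) -> U l -> rng l = v.
Proof. by move=> hU Uv Ul; rewrite (bpath_rng hU Ul Uv) rng_id. Qed.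

(** Both are prefixes of a common extension. With [bpath_meets], a boundary path has exactly one
    member in each $\Lambda^{\leq n}$, which drives (KP3') and (KP4'). *)
Lemma bpath_uniq U n a b : bpath U -> U a -> U b ->
  paths_le n a -> paths_le n b -> a = b.
Proof.
move=> hU Ua Ub la lb; have [c [d [ac bd e _]]] := bpath_directed hU Ua Ub.
by have [] := le_prefix_uniq ac bd la lb e.
Qed.

Lemma bshift_bpath U l : bpath U -> U l -> bpath (bshift l U).
Proof.
move=> hU Ul; split.
- move=> a b ab [lab Uab]; rewrite rng_comp // in lab; split=> //.
  by apply: (bpath_prefix hU (b := b)); rewrite ?src_comp // -Defs.compA.
- move=> a b [la Ua] [lb Ub]; have [c [d []]] := bpath_directed hU Ua Ub.
  rewrite !src_comp // => ac bd e Uac.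
  have e' : kcomp a c = kcomp b d.
    by apply: (@kcompI _ L l); rewrite ?rng_comp // !Defs.compA.
  by exists c, d; split=> //; split; rewrite ?rng_comp // Defs.compA.
(* A member in $\Lambda^{\leq d(l)+n}$ is split; uniqueness of prefixes in $\Lambda^{\leq d(l)}$
   identifies the first piece with [l]. *)
- move=> n; have [a [la Ua]] := bpath_meets hU (deg l + n).
  have [c [d [lc ad e Uac]]] := bpath_directed hU Ul Ua.
  have [a1 [a2 [l1 l2 h12 ea]]] := le_factor Lconv la.
  have a2d : src a2 = rng d by rewrite -ad ea src_comp.
  have [e1 e2] : l = a1 /\ c = kcomp a2 d.
    apply: (le_prefix_uniq lc _ (le_self l) l1); rewrite ?rng_comp //.
    by rewrite e ea Defs.compA.
  by exists a2; split=> //; split; rewrite e1 // -ea.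
- by move=> a [la Ua]; have := bpath_avoids hU Ua; rewrite src_comp.
Qed.

Lemma bext_mem U l m : src l = rng m -> U m -> bext l U (kcomp l m).
Proof.
move=> lm Um; exists (kid (src m)), m; split=> //; first by rewrite src_comp // rng_id.
by rewrite kcomp_id // src_comp.
Qed.

Lemma bext_self U l : U (kid (src l)) -> bext l U l.
Proof. by move=> h; rewrite -{2}(comp_idr l); apply: bext_mem; rewrite ?rng_id. Qed.

Lemma bext_bpath U l : bpath U -> U (kid (src l)) -> bpath (bext l U).
Proof.
move=> hU Ul; split.
- move=> a b ab [c [m [abc lm Um e]]]; rewrite src_comp // in abc.
  exists (kcomp b c), m; split=> //; first by rewrite rng_comp.
  by rewrite Defs.compA.
- move=> a b [c [m [ac lm Um e]]] [c' [m' [bc lm' Um' e']]].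
  have [d [d' [md md' ed Ud]]] := bpath_directed hU Um Um'.
  have cd : src c = rng d by rewrite -(src_comp ac) e src_comp.
  have cd' : src c' = rng d' by rewrite -(src_comp bc) e' src_comp.
  exists (kcomp c d), (kcomp c' d'); rewrite !rng_comp // !Defs.compA // e e' -!Defs.compA // ed.
  by split=> //; apply: bext_mem; rewrite ?rng_comp // -ed.
(* The path $lm$ lies in $\Lambda^{\leq n+d(l)}$, so it has a prefix in $\Lambda^{\leq n}$. *)
- move=> n; have [m [lm Um]] := bpath_meets hU n.
  have r : src l = rng m by rewrite (bpath_id_rng hU Ul Um).
  have := le_comp r (le_self l) lm; rewrite addrC => /(le_factor Lconv).
  move=> [a [b [la lb ab e]]]; exists a; split=> //.
  by exists b, m.
- move=> a [b [m [ab lm Um e]]] Ga; apply: (bpath_avoids hU Um).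
  rewrite -(src_comp lm) -e src_comp //; apply: hG; by rewrite -ab.
Qed.

Lemma bshift_id U v : bpath U -> U (kid v) -> bshift (kid v) U = U.
Proof.
move=> hU Uv; apply/seteqP; split=> m; rewrite /bshift /= src_id.
  by move=> [e]; rewrite id_kcomp.
by move=> Um; have r := bpath_id_rng hU Uv Um; rewrite id_kcomp.
Qed.

Lemma bext_id U v : bpath U -> U (kid v) -> bext (kid v) U = U.
Proof.
move=> hU Uv; apply/seteqP; split=> m; rewrite /bext /= src_id.
  by move=> [b [c [mb vc Uc]]]; rewrite id_kcomp // => e; apply: (bpath_prefix hU mb); rewrite e.
move=> Um; have r := bpath_id_rng hU Uv Um.
by exists (kid (src m)), m; rewrite rng_id comp_idr id_kcomp.
Qed.

Lemma bshift_ext U l : bpath U -> U (kid (src l)) -> bshift l (bext l U) = U.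
Proof.
move=> hU Ul; apply/seteqP; split=> m.
  move=> [lm [b [c [mb lc Uc]]]]; rewrite src_comp // in mb.
  rewrite -Defs.compA // => /kcompI e; apply: (bpath_prefix hU mb).
  by rewrite e ?rng_comp.
by move=> Um; have r := bpath_id_rng hU Ul Um; split=> //; apply: bext_mem.
Qed.

Lemma bext_shift U l : bpath U -> U l -> bext l (bshift l U) = U.
Proof.
move=> hU Ul; apply/seteqP; split=> a.
  by move=> [b [m [ab lm [_ Um] e]]]; apply: (bpath_prefix hU ab); rewrite e.
move=> Ua; have [c [d [lc ad e Uc]]] := bpath_directed hU Ul Ua.
by exists d, c; split=> //.
Qed.

Lemma bshift_comp U l m : src l = rng m ->
  bshift m (bshift l U) = bshift (kcomp l m) U.
Proof.
move=> lm; apply/seteqP; split=> a; rewrite /bshift /= src_comp //.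
  by move=> [ma [_]]; rewrite Defs.compA.
by move=> [ma Ua]; rewrite rng_comp // Defs.compA.
Qed.

Lemma bext_comp U l m : src l = rng m ->
  bext l (bext m U) = bext (kcomp l m) U.
Proof.
move=> lm; apply/seteqP; split=> a.
  move=> [b [c [ab lc [d [u [cd mu Uu e]]] e']]].
  have bd : src b = rng d by rewrite -(src_comp ab) e' src_comp.
  exists (kcomp b d), u; rewrite rng_comp // src_comp //; split=> //.
  by rewrite Defs.compA // e' -Defs.compA // e Defs.compA.
move=> [b [u [ab]]]; rewrite src_comp // => mu Uu e.
exists b, (kcomp m u); rewrite rng_comp //; split=> //; first exact: bext_mem.
by rewrite Defs.compA.
Qed.

(** Contrapositive of saturation, once per listed direction: some path of $v\Lambda^{\leq e_i}$ ends
    outside [G]. *)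
Lemma escape (s : seq 'I_k) v : ~ G v ->
  exists l, [/\ rng l = v, paths_le (\sum_(i <- s) unit_deg i) l & ~ G (src l)].
Proof.
elim: s v => [|i s IH] v Gv.
  by exists (kid v); rewrite big_nil rng_id src_id; split=> //; apply: le_id.
have [l [[rl ll] Gl]] : exists l, paths_le_from v (unit_deg i) l /\ ~ G (src l).
  apply: contrapT => h; apply: Gv; apply: sG; exists i => _ [l hl <-].
  by apply: contrapT => Gl; apply: h; exists l.
have [m [rm lm Gm]] := IH _ Gl.
exists (kcomp l m); rewrite rng_comp // src_comp // big_cons; split=> //.
exact: le_comp.
Qed.

Lemma bpath_exists v : ~ G v -> exists U, bpath U /\ U (kid v).
Proof.
(* Each step of the construction escapes once in every direction. *)
move=> Gv; pose one := \sum_(i <- index_enum 'I_k) unit_deg i.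
have one_gt0 i : (0 < one ord0 i)%N.
  rewrite /one summxE (bigD1 i) //= unit_degE eqxx; exact: leq_addr.
have /boolp.choice[nx hnx] : forall l, exists m, ~ G (src l) ->
    [/\ src l = rng m, paths_le one m & ~ G (src m)].
  move=> l.
  (* A default value: the chain [x] never has a source in [G]. *)
  have [Gl|Gl] := pselect (G (src l)); first by exists l.
  by have [m [h1 h2 h3]] := escape (index_enum 'I_k) Gl; exists m.
pose x := fix x j := if j is j'.+1 then kcomp (x j') (nx (x j')) else kid v.
have Gx j : ~ G (src (x j)).
  elim: j => [|j IH] /=; first by rewrite src_id.
  by have [h1 h2 h3] := hnx _ IH; rewrite src_comp.
have lx j : paths_le (one *+ j) (x j).
  elim: j => [|j IH] /=; first exact: le_id.
  by have [h1 h2 h3] := hnx _ (Gx j); rewrite mulrSr; apply: le_comp.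
have x_le i j : (i <= j)%N -> exists c, src (x i) = rng c /\ x j = kcomp (x i) c.
  move=> /subnK <-; elim: (j - i)%N => [|d [c [ic e]]].
    by exists (kid (src (x i))); rewrite rng_id comp_idr.
  have [h1 h2 h3] := hnx _ (Gx (d + i)%N); rewrite addSn /=.
  have cn : src c = rng (nx (x (d + i)%N)) by rewrite -h1 e src_comp.
  exists (kcomp c (nx (x (d + i)%N))); rewrite rng_comp // Defs.compA // -e.
  by split.
(* The boundary path consists of all prefixes of the chain [x]. *)
exists [set a | exists j b, src a = rng b /\ kcomp a b = x j]; split; last first.
  by exists 0%N, (kid v); rewrite rng_id src_id kcomp_id ?src_id.
split.
- move=> a b ab [j [c [abc e]]]; rewrite src_comp // in abc.
  by exists j, (kcomp b c); rewrite rng_comp // Defs.compA.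
- suff D i j a b c d : (i <= j)%N -> src a = rng c -> src b = rng d ->
      kcomp a c = x i -> kcomp b d = x j -> exists c' d', [/\ src a = rng c',
        src b = rng d', kcomp a c' = kcomp b d' & kcomp a c' = x j].
    move=> a b [i [c [ac ea]]] [j [d [bd eb]]].
    have [ij|/ltnW ji] := leqP i j.
      have [c' [d' [h1 h2 h3 h4]]] := D _ _ _ _ _ _ ij ac bd ea eb.
      exists c', d'; split=> //; exists j, (kid (src (x j))).
      by rewrite h4 rng_id comp_idr.
    have [c' [d' [h1 h2 h3 h4]]] := D _ _ _ _ _ _ ji bd ac eb ea.
    exists d', c'; split=> //; exists i, (kid (src (x i))).
    by rewrite -h3 h4 rng_id comp_idr.
  move=> ij ac bd ea eb; have [u [iu e]] := x_le _ _ ij.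
  have cu : src c = rng u by rewrite -iu -ea src_comp.
  by exists (kcomp c u), d; rewrite rng_comp // Defs.compA // ea -e.
(* The total of [n] bounds each entry and [one] is positive everywhere, so [n] lies below
   [one *+ j]. *)
- move=> n; pose j := (\sum_i n ord0 i)%N.
  have le : deg_le n (one *+ j).
    move=> i; rewrite mulmxnE.
    have le1 : (n ord0 i <= j)%N by rewrite /j (bigD1 i) //= leq_addr.
    have natE (a t : nat) : a *+ t = (a * t)%N.
      by elim: t => [|t IH]; rewrite ?muln0 // mulrS IH mulnS.
    by apply: (leq_trans le1); rewrite natE leq_pmull.
  have := lx j; rewrite -(subdegK le) => /(le_factor Lconv)[a [b [la _ ab e]]].
  by exists a; split=> //; exists j, b.
- move=> a [j [b [ab e]]] Ga; apply: (Gx j).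
  by rewrite -e src_comp //; apply: hG; rewrite -ab.
Qed.

End BoundaryPaths.

(** * The Kumjian-Pask family on boundary paths *)

Section Representation.
Variables (k : nat) (L : kgraph k).
Hypotheses (Lrf : row_finite L) (Lconv : locally_convex L).
Variable G : set (vertex L).
Hypotheses (hG : hereditary G) (sG : saturated G).
Variable R : comNzRingType.
Notation X := (set (kpath L)).
Notation V := (X -> R^o).

Definition through (l : kpath L) : set X := [set U | bpath G U /\ U l].

(** Pulling back along the shift sends the point mass at a boundary path $U$ starting at [src l] to
    the point mass at $lU$. *)
Definition opS l := @wcomp R X (through l) (bshift l).
Definition opT l := @wcomp R X (through (kid (src l))) (bext l).
Definition opP v := @wcomp R X (through (kid v)) id.

(** A path in the domain of the product would have both [l] and [m] as its member in $\Lambda^{\leq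
    n}$. *)
Lemma opTS_neq n l m : paths_le n l -> paths_le n m -> l <> m ->
  opT l \o opS m = 0.
Proof.
move=> ln mn lm; rewrite wcomp_comp; apply: wcomp_empty => U [[hU Ul] [hE Em]].
by apply: lm; apply: bpath_uniq hE (bext_self Ul) Em ln mn.
Qed.

Lemma opTS l : opT l \o opS l = opP (src l).
Proof.
rewrite wcomp_comp; apply: eq_wcomp => [U|U [[hU Ul] _]].
  split=> [[]//|[hU Ul]]; split=> //; split; last exact: bext_self.
  exact: bext_bpath.
exact: bshift_ext hU Ul.
Qed.

Lemma opST l : opS l \o opT l = @wcomp R X (through l) id.
Proof.
rewrite wcomp_comp; apply: eq_wcomp => [U|U [[hU Ul] _]].
  split=> [[]//|[hU Ul]]; split=> //; split; first exact: bshift_bpath.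
  by split; rewrite ?rng_id // comp_idr.
exact: bext_shift hU Ul.
Qed.

Definition endo (D : set X) (h : X -> X) : endo_nualg V :=
  to_submodule (endo_set_submodule V) (wcomp_endo (R := R) D h).

(** Each relation reduces to comparing domains and maps. For (KP4'), the boundary paths from [v] are
    partitioned by their member in $\Lambda^{\leq n}$. *)
Definition bpath_family : kp_family L (endo_nualg V).
Proof.
refine (@KPFamily k L R (endo_nualg V) (fun v => endo (through (kid v)) id)
  (fun l => endo (through l) (bshift l))
  (fun l => endo (through (kid (src l))) (bext l))
  _ _ _ _ _ _ _ _ _ _ _).
- move=> v; apply: val_inj; apply: eq_wcomp => // U [hU Uv].
  exact: bshift_id hU Uv.
- move=> v; apply: val_inj; apply: eq_wcomp => [U|U]; rewrite src_id //.
  by move=> [hU Uv]; apply: bext_id hU Uv.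
- move=> v w; apply: val_inj; rewrite raddfMn /= wcomp_comp.
  case: eqP => [->|vw].
    by apply: eq_wcomp => // U; split=> [[]|].
  apply: wcomp_empty => U [[hU Uv] [_ Uw]]; apply: vw.
  by rewrite -(bpath_id_rng hU Uv Uw) rng_id.
- move=> l m lm; apply: val_inj; rewrite /= wcomp_comp.
  apply: eq_wcomp => U.
    split=> [[[hU Ul] [_ [_ Um]]]|[hU Ulm]] //.
    have Ul : U l := bpath_prefix hU lm Ulm.
    by split=> //; split=> //; apply: bshift_bpath.
  by move=> _; apply: bshift_comp.
- move=> l m lm; apply: val_inj; rewrite /= wcomp_comp.
  apply: eq_wcomp => U.
    rewrite src_comp //; split=> [[]|[hU Um]] //; split=> //; split; first exact: bext_bpath.
    rewrite lm; exact: bpath_id (bext_bpath Lconv hG hU Um) (bext_self Um).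
  by move=> _; apply: bext_comp.
- move=> l; apply: val_inj; rewrite /= wcomp_comp; apply: eq_wcomp => // U.
  split=> [[]//|[hU Ul]]; split=> //; split=> //; exact: bpath_id hU Ul.
- move=> l; apply: val_inj; rewrite /= wcomp_comp; apply: eq_wcomp => // U.
  split=> [[]//|[hU Ul]]; split=> //; split; first exact: bshift_bpath.
  by split; rewrite ?rng_id // comp_idr.
- move=> l; apply: val_inj; rewrite /= wcomp_comp; apply: eq_wcomp => // U.
  by split=> [[]|].
- move=> l; apply: val_inj; rewrite /= wcomp_comp; apply: eq_wcomp => // U.
  split=> [[]//|[hU Ul]]; split=> //.
  have hE := bext_bpath Lconv hG hU Ul.
  by split=> //; apply: bpath_id hE (bext_self Ul).
- move=> n l m _ ln mn; apply: val_inj; rewrite raddfMn /=.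
  case: eqP => [<-|lm]; first exact: opTS.
  exact: opTS_neq ln mn lm.
- move=> v n n0; apply: val_inj; rewrite fsum_le_seq // raddf_sum /=.
  rewrite (eq_bigr (fun l => @wcomp R X (through l) id)); last first.
    by move=> l _; apply: opST.
  apply/funext => f; apply/funext => U; rewrite !fct_sumE.
  have [[hU Uv]|hU] := pselect (through (kid v) U); last first.
    rewrite {1}/wcomp asboolF // big_seq big1 // => l /(mem_le_seq Lrf)[rl ln].
    rewrite /wcomp asboolF // => -[hU' Ul]; apply: hU; split=> //.
    by rewrite -rl; apply: bpath_id hU' Ul.
  (* At [U] only the summand of its member in $\Lambda^{\leq n}$ survives. *)
  have [l [ln Ul]] := bpath_meets hU n.
  have ls : l \in le_seq v n.
    by apply/(mem_le_seq Lrf); split=> //; apply: bpath_id_rng hU Uv Ul.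
  rewrite (bigD1_seq l) ?le_seq_uniq //= big_seq_cond big1 ?addr0.
    by rewrite /wcomp !asboolT.
  move=> m /andP[/(mem_le_seq Lrf)[rm mn] /eqP ml].
  rewrite /wcomp asboolF // => -[_ Um]; apply: ml.
  exact: bpath_uniq hU Um Ul mn ln.
Defined.

Lemma bpath_family_vanish v : G v -> kpP bpath_family v = 0.
Proof.
move=> Gv; apply: val_inj; apply: wcomp_empty => U [hU Uv].
by apply: (bpath_avoids hU Uv); rewrite src_id.
Qed.

Lemma bpath_family_neq0 v (r : R) : ~ G v -> r <> 0 ->
  r *: kpP bpath_family v <> 0.
Proof.
move=> Gv r0 /(congr1 (@submodule_val _ _ _ _)).
have [U [hU Uv]] := bpath_exists Lconv hG sG Gv.
(* Evaluation on the constant function 1 at [U] returns [r]. *)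
move/(congr1 (fun F : V -> V => F (fun=> 1) U)).
rewrite linearZ /= -[LHS]/(r *: wcomp (R := R) (through (kid v)) id (fun=> 1) U).
by rewrite /wcomp asboolT // -[LHS]/(r * 1) mulr1.
Qed.

Variables (A : nualg R) (p : kp_family L A).
Hypothesis p_universal : universal_kp_family p.

(** The kernel of the map to [bpath_family] contains the generators but no $rp_v$ with $v\notin G$.
    The case $r=1$ recovers [G]; general [r] gives basicness. *)
Lemma ideal_generated_vertex v (r : R) : r <> 0 ->
  ideal_generated (kpP p @` G) (r *: kpP p v) -> G v.
Proof.
move=> r0 Jv; apply: contrapT => Gv; apply: (bpath_family_neq0 Gv r0).
have [f [[fM fP _ _] _]] := p_universal bpath_family.
rewrite -fP -linearZ.
suff : (f @^-1` [set 0]) (r *: kpP p v) by [].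
apply: (ideal_generated_min (kernel_ideal fM)) Jv => _ [w Gw <-] /=.
by rewrite fP bpath_family_vanish.
Qed.

End Representation.

(** * The lattice isomorphism *)

(** Meets and joins are defined by order alone, so an order isomorphism transports them and makes
    [E] a lattice. *)
Lemma order_iso_lattice_isomorphism (T U : Type) (F : set (set T))
    (E : set (set U)) (f : set T -> set U) :
  inclusion_lattice F -> set_bij F E f ->
  (forall X Y, F X -> F Y -> (X `<=` Y <-> f X `<=` f Y)) ->
  lattice_isomorphism F E f.
Proof.
move=> Flat fbij fle; have [fE finj fsurj] := fbij.
have fmeet X Y Z : F X -> F Y -> is_meet F X Y Z -> is_meet E (f X) (f Y) (f Z).
  move=> FX FY [FZ ZX ZY Zmax]; split; [exact: fE|exact/fle|exact/fle|].
  by move=> _ /fsurj[W FW <-] /fle WX /fle WY; apply/fle => //; apply: Zmax; auto.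
have fjoin X Y Z : F X -> F Y -> is_join F X Y Z -> is_join E (f X) (f Y) (f Z).
  move=> FX FY [FZ XZ YZ Zmin]; split; [exact: fE|exact/fle|exact/fle|].
  by move=> _ /fsurj[W FW <-] /fle XW /fle YW; apply/fle => //; apply: Zmin; auto.
split=> // _ _ /fsurj[X FX <-] /fsurj[Y FY <-].
have [[Z hZ] [W hW]] := Flat X Y FX FY.
by split; [exists (f Z); apply: fmeet|exists (f W); apply: fjoin].
Qed.

Lemma hereditary_saturated_lattice (k : nat) (L : kgraph k) :
  inclusion_lattice [set G : set (vertex L) | hereditary G /\ saturated G].
Proof.
move=> X Y [hX sX] [hY sY]; split.
  exists (X `&` Y); split=> [|v []//|v []//|W _ WX WY v Wv]; last by split; auto.
  split=> [l [Xl Yl]|v [i hi]]; first by split; [apply: hX|apply: hY].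
  by split; [apply: sX|apply: sY]; exists i => w /hi[].
(* The join is the least hereditary saturated set containing the union. *)
pose Z := [set v | forall W : set (vertex L), hereditary W -> saturated W ->
  X `<=` W -> Y `<=` W -> W v].
exists Z; split=> [|v Xv W _ _ XW _|v Yv W _ _ _ YW|W [hW sW] XW YW v Zv].
- split=> [l Zl W hW sW XW YW|v [i hi] W hW sW XW YW].
    by apply: (hW); apply: Zl.
  by apply: (sW); exists i => w /hi; apply.
- exact: XW.
- exact: YW.
- exact: Zv.
Qed.

Theorem theorem9p4 (k : nat) (hk : (0 < k)%N) (L : kgraph k)
    (L_row_finite : row_finite L) (L_locally_convex : locally_convex L)
    (R : comNzRingType)
    (KP : nualg R) (p : kp_family L KP) (p_universal : universal_kp_family p) :
  lattice_isomorphism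
    [set G : set (vertex L) | hereditary G /\ saturated G]
    [set I : set KP | graded_ideal p I /\ basic_ideal p I]
    (fun G : set (vertex L) => ideal_generated (kpP p @` G)).
Proof.
set F := [set G | _]; set E := [set I | _]; set f := fun G => _.
have fK G : F G -> kpP p @^-1` (f G) = G.
  move=> [hG sG]; apply/seteqP; split=> v.
    rewrite /= -[kpP p v]scale1r; apply: (ideal_generated_vertex L_row_finite) => //.
    exact/eqP/oner_neq0.
  by move=> Gv; apply: sub_ideal_generated; exists v.
have f_mono X Y : X `<=` Y -> f X `<=` f Y.
  move=> XY; apply: ideal_generated_min; first exact: ideal_generated_ideal.
  by move=> _ [v /XY Yv <-]; apply: sub_ideal_generated; exists v.
apply: order_iso_lattice_isomorphism; first exact: hereditary_saturated_lattice.
- split.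
  + move=> G FG; have [hG sG] := FG; split; first exact: ideal_generated_graded.
    split=> [|v r r0 /(ideal_generated_vertex L_row_finite L_locally_convex hG sG p_universal r0) Gv].
      exact: ideal_generated_ideal.
    by apply: sub_ideal_generated; exists v.
  + by move=> X Y /set_mem FX /set_mem FY e; rewrite -(fK X FX) e fK.
  + move=> I [gI bI]; exists (kpP p @^-1` I); last first.
      by rewrite /f -(graded_basic_ideal_eq hk L_row_finite gI bI).
    have [iI _] := bI; split; first exact: hereditary_vertex_set iI.
    exact: saturated_vertex_set iI.
- move=> X Y FX FY; split=> [|h]; first exact: f_mono.
  (* Taking vertex sets is monotone and inverts [f], so [f] reflects inclusion. *)
  by rewrite -(fK X FX) -(fK Y FY) => v; apply: h.
Qed.
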